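(* For a simple graph $G$ the following are equivalent: (1) $G$ is $(2,2)$-tight; (2) $G$ is derivable from $K_4$ by a finite sequence of Henneberg 1, Henneberg 2, vertex-to-$K_4$ and edge-to-$K_3$ moves.
   Context: For a graph $H$ let $f(H)=2|V(H)|-|E(H)|$. A simple graph $G$ is $(2,2)$-sparse if $f(H)\ge 2$ for every subgraph $H$ of $G$ with at least one edge, and $(2,2)$-tight if it is $(2,2)$-sparse and $f(G)=2$. Moves: Henneberg 1 adds a new vertex of degree $2$. Henneberg 2 removes an edge $uv$ and adds a new vertex $x$ with edges $xu,xv,xw$ for some further vertex $w$. Vertex-to-$K_4$ is the inverse of the $K_4$-to-vertex move, which contracts a copy of $K_4$ in $G$ to a single new vertex $v_*$: vertices of the $K_4$ are replaced by $v_*$, edges of the $K_4$ are deleted, and each edge $vw$ with $v\notin K_4$, $w\in K_4$ becomes an edge $vv_*$. Edge-to-$K_3$: given an edge $uv$ where $v$ has neighbours $a_1,\dots,a_n$, delete $v$ and its incident edges, add new vertices $v_1,v_2$ with edges $uv_1,uv_2,v_1v_2$, and join each remaining former neighbour $a_j$ of $v$ to exactly one of $v_1,v_2$ (according to some bipartition, one side possibly empty).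
   Formalization: The one-vertex graph K_1 is excluded: it has no edges and f(K_1)=2, so it is (2,2)-tight as defined, yet every graph derivable from K_4 has at least 4 vertices, so the equivalence fails for it. *)

(* Defs.v *)
From HB Require Import structures.
From mathcomp Require Import all_boot all_order all_algebra.

Set Implicit Arguments.
Unset Strict Implicit.
Unset Printing Implicit Defensive.

(* Finite simple graphs, each carrying its own vertex type because the moves
   change the number of vertices. *)
Record sgraph := SGraph {
  svertex :> finType;
  sedge : rel svertex;
  sedge_sym : symmetric sedge;
  sedge_irrefl : irreflexive sedge
}.

Notation "x -- y" := (sedge x y) (at level 30, no associativity).

Definition iso (G H : sgraph) : Prop :=
  exists2 h : G -> H, bijective h & forall x y : G, (h x -- h y) = (x -- y).

Definition neighbours (G : sgraph) (v : G) : {set G} := [set x | v -- x].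

Definition edges (G : sgraph) : {set {set G}} :=
  [set [set p.1; p.2] | p : G * G & p.1 -- p.2].

(* A subgraph is a pair (V, E), not necessarily induced. *)
Definition is_subgraph (G : sgraph) (V : {set G}) (E : {set {set G}}) : Prop :=
  E \subset edges G /\ {in E, forall e : {set G}, e \subset V}.

(* Integer-valued, so that the subtraction is not truncated. *)
Definition freedom (T : finType) (V : {set T}) (E : {set {set T}}) : int :=
  ((2 * #|V|)%:Z - #|E|%:Z)%R.

Definition sparse22 (G : sgraph) : Prop :=
  forall (V : {set G}) (E : {set {set G}}),
    is_subgraph V E -> E != set0 -> (2%:Z <= freedom V E)%R.

Definition tight22 (G : sgraph) : Prop :=
  sparse22 G /\ freedom [set: G] (edges G) = 2%:Z%R.

Section Complete.
Variable n : nat.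

Definition complete_rel : rel 'I_n := fun x y => x != y.

Lemma complete_sym : symmetric complete_rel.
Proof. by move=> x y; rewrite /complete_rel eq_sym. Qed.

Lemma complete_irrefl : irreflexive complete_rel.
Proof. by move=> x; rewrite /complete_rel eqxx. Qed.

Definition complete : sgraph := SGraph complete_sym complete_irrefl.
End Complete.

Section AddVertex.
Variables (G : sgraph) (A : {set G}).

Definition add_vertex_rel : rel (option G) := fun x y =>
  match x, y with
  | Some a, Some b => a -- b
  | Some a, None | None, Some a => a \in A
  | None, None => false
  end.

Lemma add_vertex_sym : symmetric add_vertex_rel.
Proof. by case=> [a|] [b|] //=; rewrite sedge_sym. Qed.

Lemma add_vertex_irrefl : irreflexive add_vertex_rel.
Proof. by case=> [a|] //=; rewrite sedge_irrefl. Qed.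

Definition add_vertex : sgraph := SGraph add_vertex_sym add_vertex_irrefl.
End AddVertex.

Section DeleteEdge.
Variables (G : sgraph) (u v : G).

Definition delete_edge_rel : rel G := fun x y =>
  (x -- y) && ([set x; y] != [set u; v]).

Lemma delete_edge_sym : symmetric delete_edge_rel.
Proof. by move=> x y; rewrite /delete_edge_rel sedge_sym setUC. Qed.

Lemma delete_edge_irrefl : irreflexive delete_edge_rel.
Proof. by move=> x; rewrite /delete_edge_rel sedge_irrefl. Qed.

Definition delete_edge : sgraph := SGraph delete_edge_sym delete_edge_irrefl.
End DeleteEdge.

(* The vertex set K is contracted to the single vertex None. *)
Section Contract.
Variables (G : sgraph) (K : {set G}).

Definition contract_rel : rel (option {x : G | x \notin K}) := fun x y =>
  match x, y with
  | Some a, Some b => val a -- val b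
  | Some a, None | None, Some a => [exists k in K, val a -- k]
  | None, None => false
  end.

Lemma contract_sym : symmetric contract_rel.
Proof. by case=> [a|] [b|] //=; rewrite sedge_sym. Qed.

Lemma contract_irrefl : irreflexive contract_rel.
Proof. by case=> [a|] //=; rewrite sedge_irrefl. Qed.

Definition contract : sgraph := SGraph contract_sym contract_irrefl.
End Contract.

(* The vertex v is replaced by inr true and inr false, both joined to u and to
   each other; of the other neighbours of v, those in A go to inr true and those
   outside A go to inr false. *)
Section SplitVertex.
Variables (G : sgraph) (u v : G) (A : {set G}).

Definition split_rel : rel ({x : G | x != v} + bool)%type := fun x y =>
  match x, y with
  | inl a, inl b => val a -- val b
  | inl a, inr s | inr s, inl a =>
      (val a == u) || ((val a -- v) && ((val a \in A) == s))
  | inr s, inr t => s != t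
  end.

Lemma split_sym : symmetric split_rel.
Proof.
by case=> [a|s] [b|t] //=; [rewrite sedge_sym | rewrite eq_sym].
Qed.

Lemma split_irrefl : irreflexive split_rel.
Proof. by case=> [a|s] /=; rewrite ?sedge_irrefl ?eqxx. Qed.

Definition split_vertex : sgraph := SGraph split_sym split_irrefl.
End SplitVertex.

(* Moves from G to H. *)

Definition henneberg1 (G H : sgraph) : Prop :=
  exists2 A : {set G}, #|A| = 2 & iso H (add_vertex A).

Definition henneberg2 (G H : sgraph) : Prop :=
  exists u v w : G,
    [/\ u -- v, w != u, w != v
      & iso H (@add_vertex (delete_edge u v) [set u; v; w])].

Definition is_K4 (G : sgraph) (K : {set G}) : Prop :=
  #|K| = 4 /\ {in K &, forall x y : G, x != y -> x -- y}.

(* Contraction turns distinct edges into distinct edges; as the contracted graph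
   has to be simple, no outside vertex may have two neighbours in K. *)
Definition K4_to_vertex (G H : sgraph) : Prop :=
  exists K : {set G},
    [/\ is_K4 K,
        forall w : G, w \notin K -> #|neighbours w :&: K| <= 1
      & iso H (contract K)].

Definition vertex_to_K4 (G H : sgraph) : Prop := K4_to_vertex H G.

Definition edge_to_K3 (G H : sgraph) : Prop :=
  exists (u v : G) (A : {set G}), u -- v /\ iso H (split_vertex u v A).

Inductive derivable_from (B : sgraph) : sgraph -> Prop :=
| derivable_base G : iso B G -> derivable_from B G
| derivable_step G H :
    derivable_from B G ->
    [\/ henneberg1 G H, henneberg2 G H, vertex_to_K4 G H | edge_to_K3 G H] ->
    derivable_from B H.

(* Main.v *)
Require Import Defs.
From mathcomp Require Import all_boot all_order all_algebra.
From mathcomp Require Import zify.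

Set Implicit Arguments.
Unset Strict Implicit.
Unset Printing Implicit Defensive.

(* Counting ordered adjacent pairs inside a vertex set X, (2,2)-sparsity says
   that the count is at most 4|X| - 4 for every nonempty X, and X is called
   tight in case of equality.  Each move preserves these inequalities.

   Conversely, in a tight graph the degrees are at least 2 and average less than
   4.  A vertex of degree 2 is removed by an inverse Henneberg 1 move.  For a
   vertex v of degree 3, tight sets avoiding v and meeting each other can be
   merged, while none of them contains all neighbours of v; hence either some
   edge between two neighbours can be added after removing v, or v lies in a K4.
   If this K4 cannot be contracted, some outside vertex has two neighbours in it
   and extends it to a tight set.  Let M be a maximal tight set with a vertex w
   whose only neighbours in M are x and y, with x and y adjacent.  By maximality
   wx lies in the single triangle wxy, and so does wy.  If neither edge could be
   contracted, there would be tight sets X containing w, x but not y, and Y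
   containing w, y but not x; submodularity then forbids the edge xy. *)

(** * Counting adjacent ordered pairs between vertex sets *)

Section Cross.
Variable G : sgraph.
Implicit Types (A B C X Y : {set G}) (x y v : G).

Lemma sedge_neq x y : x -- y -> x != y.
Proof. by apply: contraTneq => ->; rewrite sedge_irrefl. Qed.

(* Ordered pairs, so that cross A A is twice the number of edges inside A. *)
Definition cross A B : nat := \sum_(x in A) \sum_(y in B) (x -- y).

Lemma crossC A B : cross A B = cross B A.
Proof.
rewrite /cross exchange_big; apply: eq_bigr => x _; apply: eq_bigr => y _.
by rewrite sedge_sym.
Qed.

Lemma crossUl A B C :
  [disjoint A & B] -> cross (A :|: B) C = cross A C + cross B C.
Proof.
by move=> dAB; rewrite /cross -bigU //; apply: eq_bigl => x; rewrite !inE.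
Qed.

Lemma cross1l v B : cross [set v] B = #|neighbours v :&: B|.
Proof.
rewrite /cross big_set1 -sum1_card [RHS]big_mkcond [LHS]big_mkcond /=.
apply: eq_bigr => y _; rewrite !inE. by case: (v -- y); case: (y \in B).
Qed.

Lemma cross0l B : cross set0 B = 0.
Proof. by rewrite /cross big_set0. Qed.

Lemma crossU A B :
  [disjoint A & B] ->
  cross (A :|: B) (A :|: B) = cross A A + cross B B + 2 * cross A B.
Proof.
move=> dAB; rewrite crossUl // ![cross _ (_ :|: _)]crossC !crossUl //.
rewrite (crossC B A); lia.
Qed.

Lemma cross11 v : cross [set v] [set v] = 0.
Proof.
rewrite cross1l; apply/eqP; rewrite cards_eq0 -subset0.
by apply/subsetP=> x; rewrite !inE => /andP[vx /eqP eqx]; rewrite eqx sedge_irrefl in vx.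
Qed.

Lemma crossU1 v X : v \notin X ->
  cross (v |: X) (v |: X) = cross X X + 2 * #|neighbours v :&: X|.
Proof.
by move=> vX; rewrite crossU ?disjoints1 // cross11 cross1l.
Qed.

Lemma crossD1 v X : v \in X ->
  cross X X = cross (X :\ v) (X :\ v) + 2 * #|neighbours v :&: (X :\ v)|.
Proof. by move=> vX; rewrite -{1 2}(setD1K vX) crossU1 // setD11. Qed.

(** The union has, beyond the pairs inside [X] or inside [Y], exactly those between the two
    differences, in both orders. The exact error term is kept because its vanishing for tight sets
    later excludes an edge. *)
Lemma cross_submodular X Y :
  cross (X :|: Y) (X :|: Y) + cross (X :&: Y) (X :&: Y)
  = cross X X + cross Y Y + 2 * cross (X :\: Y) (Y :\: X).
Proof.
have dX : [disjoint X :&: Y & X :\: Y].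
  by rewrite -setI_eq0; apply/eqP/setP=> x; rewrite !inE; do 2!case: (_ \in _).
have dY : [disjoint X :&: Y & Y :\: X].
  by rewrite -setI_eq0; apply/eqP/setP=> x; rewrite !inE; do 2!case: (_ \in _).
have dU : [disjoint X & Y :\: X].
  by rewrite -setI_eq0; apply/eqP/setP=> x; rewrite !inE; do 2!case: (_ \in _).
have eU : X :|: Y = X :|: (Y :\: X).
  by apply/setP=> x; rewrite !inE; do 2!case: (_ \in _).
have eX : X = (X :&: Y) :|: (X :\: Y).
  by apply/setP=> x; rewrite !inE; do 2!case: (_ \in _).
have eY : Y = (X :&: Y) :|: (Y :\: X).
  by apply/setP=> x; rewrite !inE; do 2!case: (_ \in _).
have h1 := crossU dU; have h2 := crossU dY.
have h3 : cross X (Y :\: X) = cross (X :&: Y) (Y :\: X) + cross (X :\: Y) (Y :\: X).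
  by rewrite {1}eX crossUl.
rewrite -eU in h1; rewrite -eY in h2; lia.
Qed.

Lemma neighbours_bound v X : #|neighbours v :&: X| <= #|X :\ v|.
Proof.
apply/subset_leq_card/subsetP=> x; rewrite !inE => /andP[vx ->].
by rewrite eq_sym sedge_neq.
Qed.

Lemma cross_sum A B : cross A B = \sum_(x in A) #|neighbours x :&: B|.
Proof. by apply: eq_bigr => x _; rewrite -cross1l /cross big_set1. Qed.

Lemma cross_bound X : cross X X <= #|X| * #|X|.-1.
Proof.
rewrite cross_sum -sum_nat_const; apply: leq_sum => x xX.
by rewrite (leq_trans (neighbours_bound _ _)) // (cardsD1 x X) xX.
Qed.

(** The map from ordered adjacent pairs to edges is two-to-one, which links the counts with
    [freedom]. *)
Lemma cross_edges X :
  cross X X = 2 * #|[set e in edges G | e \subset X]|.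
Proof.
rewrite /cross pair_big /= -sum1_card big_distrr /=.
under [RHS]eq_bigr do rewrite muln1.
rewrite (big_mkcond (fun p : G * G => _ && _)) /=.
rewrite (eq_bigr (fun p : G * G =>
  if [&& p.1 \in X, p.2 \in X & p.1 -- p.2] then 1 else 0)); last first.
  by move=> [x y] _ /=; case: (x \in X); case: (y \in X); case: (x -- y).
rewrite -big_mkcond /=.
rewrite (partition_big (fun p : G * G => [set p.1; p.2])
           (mem [set e in edges G | e \subset X])) /=; last first.
  move=> [x y] /= /and3P[xX yX xy]; rewrite inE subUset !sub1set xX yX !andbT.
  by apply/imsetP; exists (x, y); rewrite ?inE.
apply: eq_bigr => e; rewrite inE => /andP[/imsetP[[a b]] /=].
rewrite inE /= => ab ->; rewrite subUset !sub1set => /andP[aX bX].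
rewrite sum1dep_card (_ : [set _ | _] = [set (a, b); (b, a)]).
  by rewrite cards2 xpair_eqE negb_and (sedge_neq ab).
apply/setP=> -[x y]; rewrite !inE /= !xpair_eqE; apply/idP/idP.
  case/andP=> /and3P[_ _ /sedge_neq xy] /eqP E.
  have : x \in [set a; b] by rewrite -E !inE eqxx.
  have : y \in [set a; b] by rewrite -E !inE eqxx orbT.
  by rewrite !inE => /orP[]/eqP ey /orP[]/eqP ex;
    rewrite ex ey ?eqxx ?orbT // in xy *; rewrite eqxx in xy.
case/orP=> /andP[/eqP-> /eqP->]; first by rewrite aX bX ab eqxx.
by rewrite aX bX sedge_sym ab setUC eqxx.
Qed.

End Cross.

Lemma cross_imset (G H : sgraph) (f : G -> H) (A B : {set G}) :
  {in A &, injective f} -> {in B &, injective f} ->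
  {in A & B, forall x y, f x -- f y = x -- y} ->
  cross (f @: A) (f @: B) = cross A B.
Proof.
move=> iA iB fE; rewrite /cross big_imset //=; apply: eq_bigr => x xA.
by rewrite big_imset //=; apply: eq_bigr => y yB; rewrite fE.
Qed.

(** * Sparsity and tightness in terms of pair counts *)

Definition sparse (G : sgraph) : Prop :=
  forall X : {set G}, X != set0 -> cross X X + 4 <= 4 * #|X|.

Definition tight_set (G : sgraph) (X : {set G}) : bool :=
  cross X X + 4 == 4 * #|X|.

Definition tight (G : sgraph) : Prop := sparse G /\ tight_set [set: G].

(** The bound of the definition is doubled. For fixed [V] the worst [E] consists of all edges inside
    [V]; a nonempty [V] with no edge inside has count 0 and meets the doubled bound anyway. *)
Lemma sparse22E (G : sgraph) : sparse22 G <-> sparse G.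
Proof.
split=> spG X.
  move=> X0; rewrite cross_edges.
  set E := [set e in _ | _].
  have [E0|E0] := eqVneq E set0.
    by rewrite E0 cards0; move: X0; rewrite -card_gt0; lia.
  have sE : is_subgraph X E.
    by split; [apply/subsetP=> e|move=> e]; rewrite inE => /andP[].
  by have := spG X E sE E0; rewrite /freedom; lia.
move=> E [sE EX] E0.
have X0 : X != set0.
  case/set0Pn: E0 => e eE; have /imsetP[[x y] _ eqe] := subsetP sE e eE.
  by apply/set0Pn; exists x; apply: (subsetP (EX e eE)); rewrite eqe !inE eqxx.
have := spG X X0; rewrite cross_edges /freedom.
have : #|E| <= #|[set e in edges G | e \subset X]|.
  by apply/subset_leq_card/subsetP=> e eE; rewrite inE (subsetP sE) //= EX.
lia.
Qed.

Lemma tight22E (G : sgraph) : tight22 G <-> tight G.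
Proof.
rewrite /tight22 /tight sparse22E /tight_set cross_edges.
have -> : [set e in edges G | e \subset [set: G]] = edges G.
  by apply/setP=> e; rewrite inE subsetT andbT.
rewrite /freedom; split=> -[sp h]; split=> //; lia.
Qed.

Lemma iso_refl (G : sgraph) : iso G G.
Proof. by exists id => //; exists id. Qed.

Lemma tight_iso (G H : sgraph) : iso G H -> tight G <-> tight H.
Proof.
case=> h bij_h hE; have inj_h := bij_inj bij_h.
have crossE (X : {set G}) : cross (h @: X) (h @: X) = cross X X.
  by apply: cross_imset => //; apply: in2W.
have hT : h @: [set: G] = [set: H].
  by have [g _ gK] := bij_h; apply/setP=> y; rewrite inE -(gK y) imset_f.
rewrite /tight /tight_set -hT crossE card_imset //.
split=> -[sp tG]; split=> // X X0.
  have [g hK gK] := bij_h.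
  have eX : X = h @: (g @: X).
    by rewrite -imset_comp (eq_imset (g := id)) ?imset_id // => x /=; rewrite gK.
  rewrite eX crossE card_imset //; apply: sp.
  by move: X0; rewrite -!card_gt0 card_imset //; apply: can_inj gK.
rewrite -crossE -(card_imset _ inj_h); apply: sp.
by move: X0; rewrite -!card_gt0 card_imset.
Qed.

(* The counts are even, so the bound fails to be sharp by at least 2. *)
Lemma tight_setN (G : sgraph) (X : {set G}) :
  sparse G -> X != set0 -> ~~ tight_set X -> cross X X + 6 <= 4 * #|X|.
Proof. by move=> sp /sp; rewrite /tight_set cross_edges; lia. Qed.

(** * Vertex sets after adding a vertex, and Henneberg 1 *)

Section OptionSets.
Variable T : finType.

Lemma set_optionP (Y : {set option T}) :
  exists X : {set T}, Y = Some @: X \/ Y = None |: Some @: X.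
Proof.
exists (Some @^-1: Y); case NY: (None \in Y); [right|left]; apply/setP=> -[x|].
- by rewrite !inE mem_imset ?inE //; apply: Some_inj.
- by rewrite !inE.
- by rewrite mem_imset ?inE //; apply: Some_inj.
- by rewrite NY; apply/esym/imsetP => -[].
Qed.

Lemma None_notin_Some (X : {set T}) : None \notin Some @: X.
Proof. by apply/imsetP => -[]. Qed.

Lemma card_Some (X : {set T}) : #|Some @: X| = #|X|.
Proof. by rewrite card_imset //; apply: Some_inj. Qed.

Lemma card_NoneU (X : {set T}) : #|None |: Some @: X| = #|X|.+1.
Proof. by rewrite cardsU1 None_notin_Some card_Some. Qed.

Lemma setT_option : [set: option T] = None |: Some @: [set: T].
Proof. by apply/setP=> -[x|]; rewrite !inE ?imset_f. Qed.

End OptionSets.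

Section AddVertexCount.
Variables (G : sgraph) (A : {set G}).
Let H := add_vertex A.

Lemma cross_add_vertex (X : {set G}) :
  @cross H (Some @: X) (Some @: X) = cross X X.
Proof. by apply: (@cross_imset G H Some) => // x y _ _; apply: Some_inj. Qed.

Lemma cross_add_vertexN (X : {set G}) :
  @cross H (None |: Some @: X) (None |: Some @: X) = cross X X + 2 * #|A :&: X|.
Proof.
rewrite (@crossU1 H) ?None_notin_Some // cross_add_vertex.
have -> : @neighbours H None :&: Some @: X = Some @: (A :&: X) :> {set H}.
  apply/setP=> -[x|]; last by rewrite inE !(negPf (None_notin_Some _)) andbF.
  by rewrite !inE !mem_imset ?inE //; apply: Some_inj.
by rewrite card_Some.
Qed.

(** The two new edges add 4 to the count, the new vertex adds 4 to the bound. The equivalence serves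
    both the move and its inverse. *)
Lemma tight_add_vertex2 : #|A| = 2 -> tight H <-> tight G.
Proof.
move=> cA.
have eT : tight_set [set: H] = tight_set [set: G].
  rewrite /tight_set setT_option cross_add_vertexN card_NoneU setIT cA; lia.
rewrite /tight eT; split=> -[sp ->]; split=> // X X0.
  have := sp (Some @: X); rewrite cross_add_vertex card_Some; apply.
  by rewrite imset_eq0.
have [Y [eX|eX]] := set_optionP X; rewrite eX.
  rewrite cross_add_vertex card_Some; apply: sp.
  by move: X0; rewrite eX imset_eq0.
rewrite cross_add_vertexN card_NoneU.
have [->|/sp] := eqVneq Y set0; first by rewrite cross0l setI0 !cards0.
have : #|A :&: Y| <= 2 by rewrite -cA subset_leq_card ?subsetIl.
lia.
Qed.

End AddVertexCount.

(** * Deleting an edge, and Henneberg 2 *)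

Lemma cross_delete_edge (G : sgraph) (u v : G) (X : {set G}) : u -- v ->
  @cross (delete_edge u v) X X + 2 * ((u \in X) && (v \in X)) = cross X X.
Proof.
move=> uv.
have pairE (a b : G) :
    \sum_(x in X) \sum_(y in X) ((x == a) && (y == b)) = (a \in X) && (b \in X).
  rewrite pair_big /= (eq_bigr (fun p => if p == (a, b) then 1 else 0)); last first.
    by move=> [x y] _ /=; rewrite xpair_eqE; case: (_ && _).
  rewrite -big_mkcondr /= (eq_bigl (fun p => (p == (a, b)) && ((a \in X) && (b \in X)))).
    by rewrite big_andbC /= big_mkcondl /=; case: ifP => // _;
      rewrite ?big_pred1_eq ?big1_eq.
  by move=> [x y] /=; case: eqP => [[-> ->]|]; rewrite ?andbT ?andbF.
have -> : cross X X = @cross (delete_edge u v) X X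
    + \sum_(x in X) \sum_(y in X) ((x == u) && (y == v))
    + \sum_(x in X) \sum_(y in X) ((x == v) && (y == u)).
  rewrite /cross -!big_split /=; apply: eq_bigr => x _.
  rewrite -!big_split /=; apply: eq_bigr => y _.
  rewrite /delete_edge_rel.
  have [/andP[/eqP-> /eqP->]|nuv] := boolP ((x == u) && (y == v)).
    by rewrite eqxx andbF uv (negPf (sedge_neq uv)).
  have [/andP[/eqP-> /eqP->]|nvu] := boolP ((x == v) && (y == u)).
    by rewrite setUC eqxx andbF sedge_sym uv.
  rewrite !addn0; case xy: (x -- y) => //=; rewrite -[_ != _]/(~~ _).
  case: eqP => // E; move: nuv nvu.
  have : x \in [set u; v] by rewrite -E !inE eqxx.
  have : y \in [set u; v] by rewrite -E !inE eqxx orbT.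
  have := sedge_neq xy; rewrite !inE.
  by move=> + /orP[]/eqP ey /orP[]/eqP ex; rewrite ex ey !eqxx.
rewrite !pairE (andbC (v \in X)); lia.
Qed.

Section Henneberg2.
Variables (G : sgraph) (u v w : G).
Hypotheses (uv : u -- v) (wu : w != u) (wv : w != v).
Let D := delete_edge u v.
Let H := @add_vertex D [set u; v; w].

Let S : {set D} := [set u; v; w].

Let card_uvw : #|S| = 3.
Proof.
by rewrite /S setUC cardsU1 !inE negb_or wu wv cards2 (sedge_neq uv).
Qed.

Let tight_setTE : tight_set [set: H] = tight_set [set: G].
Proof.
have := cross_delete_edge [set: G] uv; rewrite !inE /=.
rewrite /tight_set setT_option cross_add_vertexN card_NoneU setIT -/S card_uvw /=.
by move=> <-; rewrite -/D; lia.
Qed.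

Lemma tight_henneberg2 : tight G -> tight H.
Proof.
case=> sp tG; split; last by rewrite tight_setTE.
have spD (Y : {set D}) : Y != set0 ->
    cross Y Y + 2 * ((u \in Y) && (v \in Y)) + 4 <= 4 * #|Y|.
  by move=> /(sp Y); rewrite -(@cross_delete_edge G u v Y uv).
move=> X X0; have [Y [eX|eX]] := set_optionP X; rewrite eX.
  rewrite cross_add_vertex card_Some.
  have Y0 : Y != set0 by move: X0; rewrite eX imset_eq0.
  by have := spD Y Y0; lia.
rewrite cross_add_vertexN card_NoneU -/S.
have [->|/spD] := eqVneq Y set0; first by rewrite cross0l setI0 !cards0.
have le3 : #|S :&: Y| <= 3.
  by rewrite -card_uvw; apply/subset_leq_card/subsetIl.
(* If [Y] contains [u] and [v], the deleted edge pays for the third edge at the new vertex;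
   otherwise the new vertex has at most two neighbours in [Y]. *)
case: (boolP (_ && _)) => [uvY|uvY]; first by lia.
suff : #|S :&: Y| < #|S| by rewrite card_uvw; lia.
apply: proper_card; rewrite properE subsetIl subsetI subxx /=.
by apply: contra uvY; rewrite !subUset !sub1set => /andP[].
Qed.

(** Restoring [uv] costs 2 only in sets containing both ends; these are not tight, and by parity a
    nonempty set that is not tight has 2 to spare. *)
Lemma henneberg2_tight : tight H ->
  (forall X : {set D}, u \in X -> v \in X -> ~~ tight_set X) -> tight G.
Proof.
case=> sp tH hN; split; last by rewrite -tight_setTE.
have spD : sparse D.
  move=> X X0; have := sp (Some @: X); rewrite cross_add_vertex card_Some; apply.
  by rewrite imset_eq0.
have spG (Y : {set D}) : Y != set0 ->
    cross Y Y + 2 * ((u \in Y) && (v \in Y)) + 4 <= 4 * #|Y|.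
  move=> Y0; case: (boolP (_ && _)) => [/andP[uY vY]|_].
    by have := tight_setN spD Y0 (hN Y uY vY); lia.
  by have := spD Y Y0; lia.
by move=> X X0; rewrite -(cross_delete_edge X uv); apply: (spG X X0).
Qed.

End Henneberg2.

(** * Contracting a vertex set, and vertex-to-K4 *)

Section ContractCount.
Variables (G : sgraph) (K : {set G}).
Let H := contract K.
Local Notation T := {x : G | x \notin K}.

(* The neighbours in X of the vertex None of contract K. *)
Definition attached (X : {set G}) : {set G} := [set x in X | [exists k in K, x -- k]].

Lemma val_imset_disjoint (X : {set T}) : [disjoint val @: X & K].
Proof.
by rewrite disjoint_subset; apply/subsetP=> x /imsetP[[y yK] _ ->]; rewrite !inE.
Qed.

Lemma val_imsetE (X : {set G}) : [disjoint X & K] ->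
  exists Y : {set T}, X = val @: Y.
Proof.
move=> dX; exists (val @^-1: X); apply/setP=> x; apply/idP/imsetP.
  move=> xX; have xK : x \notin K by rewrite (disjointFr dX).
  by exists (exist _ x xK); rewrite ?inE.
by case=> y; rewrite inE => yX ->.
Qed.

Lemma card_val_imset (X : {set T}) : #|val @: X| = #|X|.
Proof. by rewrite card_imset //; apply: val_inj. Qed.

Lemma cross_contract (X : {set T}) :
  @cross H (Some @: X) (Some @: X) = cross (val @: X) (val @: X).
Proof.
have injS : {in X &, injective (Some : T -> H)} by move=> x y _ _ [].
have injv : {in X &, injective (val : T -> G)} by apply: in2W; apply: val_inj.
rewrite /cross !big_imset //=; apply: eq_bigr => x _.
by rewrite !big_imset.
Qed.

Lemma cross_contractN (X : {set T}) :
  @cross H (None |: Some @: X) (None |: Some @: X)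
  = cross (val @: X) (val @: X) + 2 * #|attached (val @: X)|.
Proof.
rewrite (@crossU1 H) ?None_notin_Some // cross_contract.
have -> : @neighbours H None :&: Some @: X
    = Some @: (val @^-1: attached (val @: X)) :> {set H}.
  apply/setP=> -[x|]; last by rewrite inE !(negPf (None_notin_Some _)) andbF.
  rewrite !inE !mem_imset; try by [apply: Some_inj|apply: val_inj].
  by rewrite !inE mem_imset 1?andbC //; apply: val_inj.
rewrite card_Some -card_val_imset; congr (_ + 2 * #|pred_of_set _|).
apply/setP=> x; apply/imsetP/idP => [[y + ->]|]; first by rewrite inE.
by rewrite inE => /andP[/imsetP[y yX ->] h]; exists y; rewrite // !inE h imset_f.
Qed.

End ContractCount.

Lemma sum_le1 (T : finType) (A : {set T}) (F : T -> nat) :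
  {in A, forall x, F x <= 1} -> \sum_(x in A) F x = #|[set x in A | 0 < F x]|.
Proof.
move=> F1; rewrite -sum1_card [RHS]big_mkcond [LHS]big_mkcond /=.
apply: eq_bigr => x _; rewrite inE; case xA: (x \in A) => //=.
by have := F1 x xA; case: (F x) => [|[]].
Qed.

Lemma exists_neighbour (G : sgraph) (K : {set G}) (x : G) :
  [exists k in K, x -- k] = (0 < #|neighbours x :&: K|).
Proof.
rewrite card_gt0; apply/exists_inP/set0Pn => -[k].
  by move=> kK xk; exists k; rewrite !inE xk.
by rewrite !inE => /andP[xk kK]; exists k.
Qed.

(** A vertex with at most one neighbour in [K] loses no edge when [K] becomes a single vertex. *)
Lemma attached_cross (G : sgraph) (K X : {set G}) :
  {in X, forall x, #|neighbours x :&: K| <= 1} -> #|attached K X| = cross X K.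
Proof.
move=> h; rewrite cross_sum sum_le1 //; congr #|pred_of_set _|.
by apply/setP=> x; rewrite !inE exists_neighbour.
Qed.

Lemma cross_K4 (G : sgraph) (K : {set G}) : is_K4 K -> cross K K = 12.
Proof.
case=> cK adj; rewrite cross_sum (eq_bigr (fun _ => 3)) ?sum_nat_const ?cK //.
move=> x xK; have := cK; rewrite (cardsD1 x) xK => -[<-].
congr #|pred_of_set _|; apply/setP=> y; rewrite !inE.
case: (boolP (y \in K)) => yK; rewrite ?andbF // !andbT.
apply/idP/idP; last by rewrite eq_sym; apply: adj.
by rewrite eq_sym; apply: sedge_neq.
Qed.

(** On n vertices the count is at most n(n - 1), and n(n - 1) is at most 4n - 4 for n from 1 to
    4. *)
Lemma small_sparse (G : sgraph) (X : {set G}) :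
  X != set0 -> #|X| <= 4 -> cross X X + 4 <= 4 * #|X|.
Proof.
rewrite -card_gt0 => X0 X4; have := cross_bound X.
by move: (#|X|) X0 X4 => [|[|[|[|[|n]]]]] //=; lia.
Qed.

Section ContractK4.
Variables (G : sgraph) (K : {set G}).
Hypotheses (K4 : is_K4 K)
  (K1 : forall w : G, w \notin K -> #|neighbours w :&: K| <= 1).
Let H := contract K.
Local Notation T := {x : G | x \notin K}.

Let cK : #|K| = 4. Proof. by case: K4. Qed.

Let cross_contract_K (X : {set T}) :
  cross (val @: X :|: K) (val @: X :|: K)
  = @cross H (None |: Some @: X) (None |: Some @: X) + 12.
Proof.
rewrite crossU ?val_imset_disjoint // cross_contractN (cross_K4 K4) attached_cross.
  by lia.
move=> x xX; apply: K1; apply/negP=> xK.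
by have := disjointFr (val_imset_disjoint X) xX; rewrite xK.
Qed.

Let card_contract_K (X : {set T}) : #|val @: X :|: K| = #|X| + 4.
Proof.
rewrite -cK -(card_val_imset X) cardsU.
have := val_imset_disjoint X; rewrite -setI_eq0 => /eqP->.
by rewrite cards0 subn0.
Qed.

(** Contracting [K] removes 12 from the count and three vertices, so both sides of the inequality
    drop by 12. *)
Lemma tight_contract_K4 : tight H <-> tight G.
Proof.
have eT : tight_set [set: H] = tight_set [set: G].
  have := cross_contract_K setT; have := card_contract_K setT.
  have -> : val @: [set: T] :|: K = setT.
    apply/setP=> x; rewrite !inE; case: (boolP (x \in K)) => xK; rewrite ?orbT //.
    by rewrite orbF; apply/imsetP; exists (exist _ x xK).
  have TE : [set: H] = None |: Some @: [set: T] := setT_option _.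
  have cT : #|[set: H]| = #|[set: T]|.+1 by rewrite TE card_NoneU.
  by rewrite /tight_set cT TE => -> ->; lia.
rewrite /tight eT; split=> -[sp tG]; split=> // X X0.
  have [dX|] := boolP [disjoint X & K].
    have [Y eX] := val_imsetE dX; rewrite eX -cross_contract card_val_imset.
    rewrite -(card_Some Y); apply: sp; rewrite imset_eq0.
    by move: X0; rewrite eX imset_eq0.
  (* A set meeting [K] is handled by submodularity: [X :|: K] is bounded through the contraction,
     [X :&: K] has at most four vertices, and [K] itself is tight. *)
  rewrite -setI_eq0 => XK0.
  have [|Y eY] := @val_imsetE _ K (X :\: K).
    by rewrite -setI_eq0; apply/eqP/setP=> x; rewrite !inE; case: (_ \in K); rewrite ?andbF.
  have eU : X :|: K = val @: Y :|: K.
    by rewrite -eY; apply/setP=> x; rewrite !inE; case: (x \in K); rewrite ?orbT.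
  have h1 := cross_contract_K Y; have h2 := card_contract_K Y.
  have spH : @cross H (None |: Some @: Y) (None |: Some @: Y) + 4 <= 4 * #|Y|.+1.
    by rewrite -card_NoneU; apply: sp; rewrite -card_gt0 card_NoneU.
  have /small_sparse : X :&: K != set0 by [].
  move=> /(_ (leq_trans (subset_leq_card (subsetIr X K)) (eq_leq cK))).
  have := cross_submodular X K; have := cardsUI X K.
  by rewrite eU (cross_K4 K4); lia.
have spN (Y : {set T}) :
    @cross H (None |: Some @: Y) (None |: Some @: Y) + 4 <= 4 * #|Y|.+1.
  have := sp (val @: Y :|: K); rewrite cross_contract_K card_contract_K.
  by rewrite -card_gt0 card_contract_K addn4 => /(_ isT); lia.
have [Y [eX|eX]] := set_optionP X; rewrite eX.
  rewrite cross_contract card_Some -card_val_imset; apply: sp.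
  by move: X0; rewrite eX !imset_eq0.
by rewrite card_NoneU; apply: spN.
Qed.

End ContractK4.

(** * Edge-to-K3 preserves tightness *)

Lemma cross_imset_le (G H : sgraph) (f : G -> H) (X : {set G}) :
  {in X &, injective f} -> {in X &, forall x y, x -- y -> f x -- f y} ->
  cross X X <= cross (f @: X) (f @: X).
Proof.
move=> fI fE; rewrite /cross big_imset //=; apply: leq_sum => x xX.
rewrite big_imset //=; apply: leq_sum => y yX.
by have := fE x y xX yX; case: (x -- y) => // ->.
Qed.

Section SplitTight.
Variables (G : sgraph) (u v : G) (A : {set G}).
Hypothesis uv : u -- v.
Let H := split_vertex u v A.

Definition split_proj (x : {x : G | x != v} + bool) : G :=
  match x with inl a => val a | inr _ => v end.
Let p : H -> G := split_proj.

Let p_adj (x y : H) : x -- y -> p x != p y -> p x -- p y.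
Proof.
case: x y => [a|s] [b|t] //= h ne; last by rewrite eqxx in ne.
  by case/orP: h => [/eqP->|/andP[]].
by rewrite sedge_sym; case/orP: h => [/eqP->|/andP[]].
Qed.

Let p_inj (X : {set H}) : ~~ ((inr true \in X) && (inr false \in X)) ->
  {in X &, injective p}.
Proof.
move=> h [[a aP]|s] [[b bP]|t] hx hy //=.
- by move=> e; congr inl; apply: val_inj.
- by move=> e; case/eqP: (aP).
- by move=> e; case/eqP: (bP).
- by case: s t hx hy => -[] // hx hy; rewrite hx hy in h.
Qed.

Let p_le (X : {set H}) : ~~ ((inr true \in X) && (inr false \in X)) ->
  cross X X <= cross (p @: X) (p @: X).
Proof.
move=> h; have pI := p_inj h; apply: cross_imset_le => // x y xX yX xy.
by apply: p_adj => //; apply: contraTneq xy => /pI -> //; rewrite sedge_irrefl.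
Qed.

(** The projection to [G] merges the two new vertices. It loses the edge between them and, when [u]
    is present, one of the two edges to [u]; any other neighbour of [v] has only one edge to
    them. *)
Let cross_both (X : {set H}) : inr true \in X -> inr false \in X ->
  cross X X = cross (p @: X) (p @: X) + 2 + 2 * (u \in p @: X)
  /\ #|X| = #|p @: X|.+1.
Proof.
move=> tX fX; set Z := X :\ inr true :\ inr false.
have eX : X = inr true |: (inr false |: Z).
  by apply/setP=> x; rewrite !inE; case: eqP => [->//|_]; case: eqP => [->|].
have pZ : {in Z &, injective p}.
  by apply: p_inj; rewrite !inE eqxx.
have vZ : v \notin p @: Z.
  apply/imsetP => -[[[a aP]|[]]]; rewrite !inE //= => _ e.
  by have := aP; rewrite -e eqxx.
have eP : p @: X = v |: p @: Z.
  by rewrite eX !imsetU !imset_set1 setUA setUid.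
have fZ : inr false \notin Z by rewrite !inE eqxx.
have tZ : inr true \notin inr false |: Z by rewrite !inE eqxx.
have cZ : cross Z Z = cross (p @: Z) (p @: Z).
  apply/esym/cross_imset => // x y; rewrite !inE.
  by case: x y => [a|[]] [b|[]].
have uv' := sedge_neq uv.
have nE : #|@neighbours H (inr true) :&: Z| + #|@neighbours H (inr false) :&: Z|
    = #|neighbours v :&: p @: Z| + (u \in p @: Z).
  have -> : (u \in p @: Z : nat) = \sum_(y in p @: Z) (y == u).
    case: (boolP (u \in _)) => uZ.
      rewrite (bigD1 u) //= eqxx big1 // => y /andP[_ /negPf-> //].
    by rewrite big1 // => y yZ; case: eqP => // e; rewrite -e yZ in uZ.
  rewrite -!cross1l /cross !big_set1 -!big_split /= big_imset //=.
  apply: eq_bigr => -[a|[]]; rewrite !inE //= => _.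
  rewrite (sedge_sym v).
  case: eqP => [->|_] /=; first by rewrite uv.
  by case: (_ -- _); case: (_ \in A).
have c1 : #|@neighbours H (inr true) :&: (inr false |: Z)|
    = #|@neighbours H (inr true) :&: Z|.+1.
  rewrite setIUr (_ : _ :&: [set _] = [set inr false]).
    by rewrite cardsU1 inE (negPf fZ) andbF.
  by apply/setP=> x; rewrite !inE; case: eqP => [->|]; rewrite ?andbF.
split.
  rewrite eP {1 2}eX !crossU1 // c1 cZ !inE (negPf uv') /=.
  have arith m n1 n2 n3 n4 :
    n1 + n2 = n3 + n4 -> m + 2 * n2 + 2 * n1.+1 = m + 2 * n3 + 2 + 2 * n4 by lia.
  exact: arith nE.
rewrite eP {1}eX !cardsU1 tZ fZ vZ card_in_imset //.
Qed.

Lemma tight_split : tight G -> tight H.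
Proof.
case=> sp tG; split=> [X X0|].
  have pX0 : p @: X != set0 by rewrite imset_eq0.
  have := sp _ pX0.
  (* With both new vertices in [X] the count grows by at most 4 for one extra vertex; otherwise the
     projection is injective on [X] and preserves adjacency. *)
  case: (boolP ((inr true \in X) && (inr false \in X))) => [/andP[tX fX]|nX].
    by have [-> ->] := cross_both tX fX; case: (u \in _); lia.
  by rewrite (card_in_imset (p_inj nX)); have := p_le nX; lia.
have [] := @cross_both setT; rewrite ?inE //.
have -> : p @: setT = setT.
  apply/setP=> x; rewrite inE; apply/imsetP.
  have [->|xv] := eqVneq x v; first by exists (inr true).
  by exists (inl (exist _ x xv)).
by move: tG; rewrite /tight_set inE => + -> ->; lia.
Qed.

End SplitTight.

(** * Contracting an edge that lies in exactly one triangle *)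

Section EdgeContraction.
Variables (G : sgraph) (a b u : G).
Hypotheses (ab : a -- b) (ua : u -- a) (ub : u -- b).
Hypothesis uniq_u : forall w, w -- a -> w -- b -> w = u.
Hypothesis tightN :
  forall X : {set G}, a \in X -> b \in X -> u \notin X -> ~~ tight_set X.
Let K := [set a; b].
Let H := contract K.
Local Notation T := {x : G | x \notin K}.

Let uK : u \notin K.
Proof. by rewrite !inE negb_or !sedge_neq. Qed.

Let cross_K : cross K K = 2.
Proof.
rewrite crossU1 ?inE ?sedge_neq // cross11 (_ : _ :&: _ = [set b]) ?cards1 //.
by apply/setP=> x; rewrite !inE; case: eqP => [->|]; rewrite ?andbF // ab.
Qed.

Let cross_pair (X : {set T}) :
  cross (val @: X) K = #|attached K (val @: X)| + (u \in val @: X).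
Proof.
have card_nb x : #|neighbours x :&: K| = (x -- a) + (x -- b).
  by rewrite -cross1l /cross big_set1 big_setU1 ?inE ?sedge_neq // big_set1.
have -> : (u \in val @: X : nat) = \sum_(y in val @: X) (y == u).
  case: (boolP (u \in _)) => uX.
    by rewrite (bigD1 u) //= eqxx big1 // => y /andP[_ /negPf->].
  by rewrite big1 // => y yX; case: eqP => // e; rewrite -e yX in uX.
have -> : #|attached K (val @: X)|
    = \sum_(x in val @: X) [exists k in K, x -- k].
  rewrite -sum1_card [LHS]big_mkcond [RHS]big_mkcond /=.
  by apply: eq_bigr => x _; rewrite inE; case: (x \in _) => //=; case: ifP.
rewrite cross_sum -big_split /=; apply: eq_bigr => x _.
rewrite exists_neighbour card_nb; have [->|xu] := eqVneq x u.
  by rewrite ua ub.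
case xa: (x -- a); case xb: (x -- b) => //.
by rewrite (uniq_u xa xb) eqxx in xu.
Qed.

Let crossN (X : {set T}) :
  cross (val @: X :|: K) (val @: X :|: K)
  = @cross H (None |: Some @: X) (None |: Some @: X) + 2 + 2 * (u \in val @: X).
Proof.
rewrite crossU ?val_imset_disjoint // cross_contractN cross_K cross_pair.
by rewrite mulnDr addnA; congr (_ + _); rewrite addnAC.
Qed.

Let cardN (X : {set T}) : #|val @: X :|: K| = #|X| + 2.
Proof.
have cK : #|K| = 2 by rewrite cards2 sedge_neq.
rewrite -cK -(card_val_imset X) cardsU.
have := val_imset_disjoint X; rewrite -setI_eq0 => /eqP->.
by rewrite cards0 subn0.
Qed.

(** Contraction loses [ab] and merges [ua] with [ub]: for one vertex fewer, the count drops by 4 if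
    [u] is in the set and by only 2 otherwise. The missing 2 come from [tightN] and parity. *)
Lemma tight_contract_edge : tight G -> tight H.
Proof.
case=> sp tG; split; last first.
  have := crossN setT; have := cardN setT.
  have -> : val @: [set: T] :|: K = setT.
    apply/setP=> x; rewrite in_setU !in_setT;
    case: (boolP (x \in K)) => xK; rewrite ?orbT //.
    by rewrite orbF; apply/imsetP; exists (exist _ x xK).
  have -> : u \in val @: [set: T] by apply/imsetP; exists (exist _ u uK).
  have TE : [set: H] = None |: Some @: [set: T] := setT_option _.
  have cT : #|[set: H]| = #|[set: T]|.+1 by rewrite TE card_NoneU.
  move=> cE xE; move: tG; rewrite /tight_set cE xE cT TE; lia.
have spN (Y : {set T}) :
    @cross H (None |: Some @: Y) (None |: Some @: Y) + 4 <= 4 * #|Y|.+1.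
  have Y0 : val @: Y :|: K != set0 by rewrite -card_gt0 cardN addn2.
  case: (boolP (u \in val @: Y)) => uY.
    by have := sp _ Y0; rewrite crossN cardN uY; lia.
  have : ~~ tight_set (val @: Y :|: K).
    by apply: tightN; rewrite !inE ?eqxx ?orbT // (negPf uY) /= -!in_set1 -in_setU.
  move=> /(tight_setN sp Y0); rewrite crossN cardN (negPf uY); lia.
move=> X X0; have [Y [eX|eX]] := set_optionP X; rewrite eX.
  rewrite cross_contract card_Some -card_val_imset; apply: sp.
  by move: X0; rewrite eX !imset_eq0.
by rewrite card_NoneU; apply: spN.
Qed.

Lemma edge_contraction : edge_to_K3 H G.
Proof.
pose u' : H := Some (exist _ u uK).
have abN := sedge_neq ab.
(* The side [true] stands for [a] and [false] for [b]. A neighbour of the contracted vertex that is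
   not adjacent to [a] is adjacent to [b]. *)
exists u', None, [set x : H | if x is Some y then val y -- a else false].
split; first by apply/exists_inP; exists a; rewrite ?inE ?eqxx.
set S := split_vertex _ _ _.
pose h (x : G) : S :=
  if insub x is Some z then inl (exist _ (Some z) isT) else inr (x == a).
pose g (y : S) : G :=
  match y with
  | inl (exist (Some z) _) => val z
  (* Unreachable value: the left summand excludes the split vertex [None]. *)
  | inl _ => a
  | inr s => if s then a else b
  end.
have hg : cancel h g.
  move=> x; rewrite /h; case: insubP => [z _ <- //|] /=.
  by rewrite !inE negbK; case: eqP => [->|_] //= /eqP.
have gh : cancel g h.
  case=> [[[z|] //= zN]|[]] /=; rewrite /h.
  - by rewrite valK; congr inl; apply: val_inj.
  - by rewrite insubF ?eqxx // !inE eqxx.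
  - by rewrite insubF ?(eq_sym b) ?(negPf abN) // !inE eqxx orbT.
exists h; first by exists g.
(* Uniqueness of [u] makes the bipartition exact: no other vertex is adjacent to both [a] and
   [b]. *)
have adj s (x : G) : x \notin K -> ((x == u) ||
   ([exists k in K, x -- k] && ((x -- a) == s))) = (x -- if s then a else b).
  move=> xK; have [->|xu] := eqVneq x u; first by case: s; rewrite ?ua ?ub.
  have -> : [exists k in K, x -- k] = (x -- a) || (x -- b).
    apply/exists_inP/orP => [[k]|[]].
    - by rewrite !inE => /orP[]/eqP-> ->; [left|right].
    - by exists a; rewrite ?inE ?eqxx.
    - by exists b; rewrite ?inE ?eqxx ?orbT.
  case xa: (x -- a); case xb: (x -- b); case: s => //=; rewrite ?xa ?xb //.
  by rewrite (uniq_u xa xb) eqxx in xu.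
have inr_adj x y : x \in K -> y \in K -> ((x == a) != (y == a)) = (x -- y).
  rewrite !inE => /orP[]/eqP-> /orP[]/eqP->;
    by rewrite ?eqxx ?sedge_irrefl // (eq_sym b) (negPf abN) ?ab // sedge_sym ab.
have inrE x : x \in K -> (if x == a then a else b) = x.
  by rewrite !inE; case: eqP => [->|_] //= /eqP.
move=> x y; rewrite /h.
case: insubP => [x' _ <-|]; case: insubP => [y' _ <-|] //=; rewrite ?negbK.
- by move=> yK; rewrite -[in RHS](inrE y yK) -(adj _ _ (valP x')) inE.
- by move=> xK; rewrite [RHS]sedge_sym -[in RHS](inrE x xK) -(adj _ _ (valP y')) inE.
- by move=> yK xK; apply: inr_adj.
Qed.

End EdgeContraction.

(** * Every derivable graph is tight *)

Lemma tight_step (G H : sgraph) :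
  [\/ henneberg1 G H, henneberg2 G H, vertex_to_K4 G H | edge_to_K3 G H] ->
  tight G -> tight H.
Proof.
case=> [[A cA]|[u [v [w [uv wu wv]]]]|[K [K4 K1]]|[u [v [A [uv]]]]] /tight_iso e tG.
- by apply/e/tight_add_vertex2.
- by apply/e/tight_henneberg2.
- by apply/(tight_contract_K4 K4 K1)/e.
- by apply/e/tight_split.
Qed.

Lemma tight_complete4 : tight (complete 4).
Proof.
split=> [X X0|].
  by apply: small_sparse X0 _; have := max_card (mem X); rewrite card_ord.
rewrite /tight_set cross_K4 ?cardsT ?card_ord //.
by split=> [|x y _ _]; rewrite ?cardsT ?card_ord.
Qed.

Lemma tight_derivable (G : sgraph) : derivable_from (complete 4) G -> tight G.
Proof.
elim=> [H e|H1 H2 _ tH st]; last exact: tight_step st tH.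
by apply/(tight_iso e); apply: tight_complete4.
Qed.

(** * Removing a vertex and adding an edge *)

Section RemoveVertex.
Variables (G : sgraph) (v : G).

Definition remove_vertex_rel : rel {x : G | x != v} := fun x y => val x -- val y.

Lemma remove_vertex_sym : symmetric remove_vertex_rel.
Proof. by move=> x y; rewrite /remove_vertex_rel sedge_sym. Qed.

Lemma remove_vertex_irrefl : irreflexive remove_vertex_rel.
Proof. by move=> x; rewrite /remove_vertex_rel sedge_irrefl. Qed.

Definition remove_vertex : sgraph := SGraph remove_vertex_sym remove_vertex_irrefl.
End RemoveVertex.

Section AddEdge.
Variables (G : sgraph) (u v : G).

(** The conjunct [x != y] keeps the relation irreflexive also when [u = v]. *)
Definition add_edge_rel : rel G := fun x y =>
  (x -- y) || ((x != y) && ([set x; y] == [set u; v])).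

Lemma add_edge_sym : symmetric add_edge_rel.
Proof. by move=> x y; rewrite /add_edge_rel sedge_sym eq_sym setUC. Qed.

Lemma add_edge_irrefl : irreflexive add_edge_rel.
Proof. by move=> x; rewrite /add_edge_rel sedge_irrefl eqxx. Qed.

Definition add_edge : sgraph := SGraph add_edge_sym add_edge_irrefl.

Lemma delete_add_edge (x y : G) : ~~ (u -- v) ->
  @sedge (@delete_edge add_edge u v) x y = (x -- y).
Proof.
move=> uv; rewrite /= /delete_edge_rel /= /add_edge_rel.
case: (eqVneq [set x; y]) => [e|_]; rewrite ?andbF ?andbT ?orbF //.
apply/esym/negbTE; apply: contra uv => xy.
have : x \in [set u; v] by rewrite -e !inE eqxx.
have : y \in [set u; v] by rewrite -e !inE eqxx orbT.
by rewrite !inE => /orP[]/eqP ey /orP[]/eqP ex; rewrite ex ey ?sedge_irrefl // in xy *;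
  rewrite sedge_sym.
Qed.
End AddEdge.

Lemma iso_add_vertex (G H : sgraph) (f : H -> G) (v : G) (A : {set H}) :
  injective f -> (forall y, f y != v) -> (forall x, x != v -> exists y, x = f y) ->
  (forall x y, (f x -- f y) = (x -- y)) -> (forall y, (f y -- v) = (y \in A)) ->
  iso G (add_vertex A).
Proof.
move=> fI fv fS fE fA.
pose g (y : add_vertex A) : G := oapp f v y.
(* [pick] inverts [f], and its failure value [None], reached exactly at [v], is the added vertex. *)
pose h (x : G) : add_vertex A := [pick y | f y == x].
have hf y : h (f y) = Some y.
  by rewrite /h; case: pickP => [z /eqP/fI->|/(_ y)] //; rewrite eqxx.
have hv : h v = None.
  by rewrite /h; case: pickP => // z; rewrite (negPf (fv z)).
have hP x : (exists2 y, x = f y & h x = Some y) \/ x = v.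
  have [->|/fS[y ->]] := eqVneq x v; first by right.
  by left; exists y.
exists h.
  exists g; first by move=> x; case: (hP x) => [[y -> _]|->]; rewrite ?hf ?hv.
  by case=> [y|]; rewrite /g /= ?hf ?hv.
move=> x y; case: (hP x) => [[a -> _]|->]; case: (hP y) => [[b -> _]|->];
  rewrite ?hf ?hv /= ?fE -?fA ?sedge_irrefl //.
by rewrite sedge_sym.
Qed.

Lemma card_contract (G : sgraph) (K : {set G}) : #|contract K| + #|K| = #|G|.+1.
Proof. by rewrite card_option card_sig addSn addnC cardC. Qed.

(** * Degrees and tight sets in a tight graph *)

Section Reduction.
Variable G : sgraph.
Hypothesis tG : tight G.
Implicit Types (v x y z : G) (X Y M : {set G}).

Let spG : sparse G. Proof. by case: tG. Qed.

(** A third edge from [v] would add 6 to the count while the bound grows only by 4. *)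
Lemma degree_leq v X : tight_set X -> v \notin X -> X != set0 ->
  #|neighbours v :&: X| <= 2.
Proof.
move=> /eqP tX vX X0; have := @spG (v |: X).
rewrite crossU1 // cardsU1 vX -card_gt0 cardsU1 vX => /(_ isT); lia.
Qed.

(** Otherwise deleting [v] would lower the count by at most 2 and the bound by 4, against sparsity
    of the rest. *)
Lemma degree_geq2 v : 1 < #|G| -> 1 < #|neighbours v|.
Proof.
move=> G1; have /eqP := tG.2; rewrite (crossD1 (in_setT v)).
have : setT :\ v != set0.
  by rewrite -card_gt0; have := cardsD1 v setT; rewrite cardsT in_setT; lia.
move=> /spG; have := cardsD1 v setT; rewrite in_setT.
have : #|neighbours v :&: (setT :\ v)| <= #|neighbours v|.
  exact/subset_leq_card/subsetIl.
lia.
Qed.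

Lemma exists_degree_leq3 : exists v, #|neighbours v| <= 3.
Proof.
apply/existsP; apply: contraT; rewrite negb_exists => /forallP h.
have /eqP := tG.2; rewrite cross_sum.
have : \sum_(x in [set: G]) 4 <= \sum_(x in [set: G]) #|neighbours x :&: setT|.
  by apply: leq_sum => x _; rewrite setIT ltnNge.
by rewrite sum_nat_const cardsT; lia.
Qed.

(** Sparsity bounds the counts of union and intersection; with [X] and [Y] tight, submodularity
    forces equality in both and leaves nothing for the crossing pairs. *)
Lemma tight_set_meet X Y : tight_set X -> tight_set Y -> X :&: Y != set0 ->
  tight_set (X :|: Y) /\ cross (X :\: Y) (Y :\: X) = 0.
Proof.
move=> /eqP tX /eqP tY XY0; have := spG XY0.
have XU0 : X :|: Y != set0.
  by apply: contraNneq XY0 => /eqP; rewrite setU_eq0 => /andP[/eqP-> _]; rewrite set0I.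
have := spG XU0; have := cross_submodular X Y; have := cardsUI X Y.
by rewrite /tight_set; lia.
Qed.

(** Two neighbours add exactly 4 to both sides; [degree_leq] excludes a third. *)
Lemma tight_set_add X x y z : tight_set X -> x \in X -> y \in X -> z \notin X ->
  x != y -> z -- x -> z -- y ->
  tight_set (z |: X) /\ neighbours z :&: X = [set x; y].
Proof.
move=> tX xX yX zX xy zx zy.
have X0 : X != set0 by apply/set0Pn; exists x.
have s : [set x; y] \subset neighbours z :&: X.
  by rewrite subUset !sub1set !inE zx zy xX yX.
have le2 := degree_leq tX zX X0.
have e : neighbours z :&: X = [set x; y].
  by apply/esym/eqP; rewrite eqEcard s cards2 xy.
split=> //; move: tX; rewrite /tight_set crossU1 // e cards2 xy cardsU1 zX; lia.
Qed.

(** * Inverse Henneberg moves *)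

Lemma card_remove_vertex v : #|remove_vertex v| = #|G|.-1.
Proof. by rewrite card_sig (cardC1 v). Qed.

Lemma remove_vertex_onto v (x : G) : x != v -> exists y : remove_vertex v, x = val y.
Proof. by move=> xv; exists (exist _ x xv). Qed.

Lemma henneberg1_inverse v : #|neighbours v| = 2 ->
  exists2 H : sgraph, tight H /\ #|H| = #|G|.-1 & henneberg1 H G.
Proof.
move=> deg2; pose H := remove_vertex v.
pose A : {set H} := [set y | v -- val y].
have cA : #|A| = 2.
  rewrite -deg2 -(card_imset _ (val_inj : injective (val : H -> G))).
  congr #|pred_of_set _|; apply/setP=> x; rewrite inE; apply/imsetP/idP.
    by case=> y; rewrite inE => vy ->.
  move=> vx; have xv : x != v by rewrite eq_sym sedge_neq.
  by exists (exist _ x xv); rewrite ?inE.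
have e : iso G (add_vertex A).
  apply: (@iso_add_vertex _ _ (val : H -> G) v).
  - exact: val_inj.
  - by case.
  - exact: remove_vertex_onto.
  - by [].
  - by move=> y; rewrite inE sedge_sym.
exists H; last by exists A.
by split; [apply/(tight_add_vertex2 cA)/(tight_iso e) | apply: card_remove_vertex].
Qed.

Lemma henneberg2_inverse v a b c : neighbours v = [set a; b; c] ->
  a != b -> a != c -> b != c -> ~~ (a -- b) ->
  (forall X, v \notin X -> a \in X -> b \in X -> ~~ tight_set X) ->
  exists2 H : sgraph, tight H /\ #|H| = #|G|.-1 & henneberg2 H G.
Proof.
move=> Nv ab ac bc nab hN.
have nbr x : x \in [set a; b; c] -> x != v.
  by rewrite -Nv inE eq_sym; apply: sedge_neq.
have av : a != v by apply: nbr; rewrite !inE eqxx.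
have bv : b != v by apply: nbr; rewrite !inE eqxx orbT.
have cv : c != v by apply: nbr; rewrite !inE eqxx orbT.
pose a' : remove_vertex v := exist _ a av.
pose b' : remove_vertex v := exist _ b bv.
pose c' : remove_vertex v := exist _ c cv.
(* [H] is [G] without [v] and with the edge [ab]; deleting this edge again gives [D], whose
   adjacency is that of [G] without [v]. *)
pose H := add_edge a' b'; pose D := @delete_edge H a' b'.
have abH : @sedge H a' b' by rewrite /= /add_edge_rel eqxx andbT orbC -val_eqE /= ab.
have DE (x y : D) : (x -- y) = (val x -- val y).
  exact: (@delete_add_edge (remove_vertex v) a' b').
have e : iso G (@add_vertex D [set a'; b'; c']).
  apply: (@iso_add_vertex _ _ (val : D -> G) v).
  - exact: val_inj.
  - by case.
  - exact: remove_vertex_onto.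
  - by move=> x y; rewrite DE.
  - move=> y; rewrite sedge_sym.
    by have /setP/(_ (val y)) := Nv; rewrite !inE => ->.
have ca : c' != a' by rewrite -val_eqE /= eq_sym.
have cb : c' != b' by rewrite -val_eqE /= eq_sym.
exists H; last by exists a', b', c'.
split; last exact: card_remove_vertex.
apply: (henneberg2_tight abH ca cb); first exact/(tight_iso e).
move=> X aX bX.
have xE : @cross G ((val : D -> G) @: X) ((val : D -> G) @: X) = @cross D X X.
  by apply: cross_imset => [x y _ _|x y _ _|x y _ _];
    [apply: val_inj | apply: val_inj | rewrite DE].
have := hN ((val : D -> G) @: X); rewrite /tight_set xE card_imset; last exact: val_inj.
apply.
- by apply/imsetP => -[y _ e']; case/eqP: (valP y).
- by apply/imsetP; exists a'.
- by apply/imsetP; exists b'.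
Qed.

(** The two obstacles to replacing [v] by an edge [xy]: the edge exists already, or a tight set of
    the rest leaves no room for it. *)
Definition blocked v x y : bool :=
  (x -- y) || [exists X : {set G}, [&& tight_set X, v \notin X, x \in X & y \in X]].

(** If a tight set blocks [a] and [b], it misses [c], and a tight set blocking [c] with either could
    be merged with it. So [c] is adjacent to both, and adding [c] gives a tight set with all three
    neighbours, which [degree_leq] forbids. *)
Lemma blocked_adj v a b c : neighbours v = [set a; b; c] ->
  a != b -> a != c -> b != c ->
  blocked v a b -> blocked v a c -> blocked v b c -> a -- b.
Proof.
move=> Nv ab ac bc.
have notall X : tight_set X -> v \notin X -> a \in X -> b \in X -> c \notin X.
  move=> tX vX aX bX; apply/negP=> cX.
  have X0 : X != set0 by apply/set0Pn; exists a.
  have := degree_leq tX vX X0; rewrite (setIidPl _); last first.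
    by rewrite Nv !subUset !sub1set aX bX cX.
  by rewrite Nv setUC cardsU1 !inE negb_or cards2 ab eq_sym ac eq_sym bc.
case/orP=> // /existsP[X /and4P[tX vX aX bX]].
have cX := notall X tX vX aX bX.
have blk x : x \in X -> blocked v x c -> c -- x.
  move=> xX /orP[|/existsP[Y /and4P[tY vY xY cY]]]; first by rewrite sedge_sym.
  have XY0 : X :&: Y != set0 by apply/set0Pn; exists x; rewrite inE xX.
  have [tU _] := tight_set_meet tX tY XY0.
  have := notall _ tU; rewrite !inE negb_or vX vY aX bX cY orbT.
  by move=> /(_ isT isT isT).
move=> /(blk a aX) ca /(blk b bX) cb.
have [tc _] := tight_set_add tX aX bX cX ab ca cb.
have cN : c \in neighbours v by rewrite Nv !inE eqxx orbT.
have vc : v != c by move: cN; rewrite inE => /sedge_neq.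
have := notall _ tc; rewrite !inE negb_or vc vX aX bX eqxx !orbT.
by move=> /(_ isT isT isT).
Qed.

Lemma blocked_or_henneberg2 v a b c : neighbours v = [set a; b; c] ->
  a != b -> a != c -> b != c ->
  blocked v a b \/ exists2 H : sgraph, tight H /\ #|H| = #|G|.-1 & henneberg2 H G.
Proof.
move=> Nv ab ac bc; have [|nb] := boolP (blocked v a b); first by left.
move: nb; rewrite negb_or negb_exists => /andP[nab /forallP h].
right; apply: henneberg2_inverse Nv ab ac bc nab _ => X vX aX bX.
by apply: contra (h X) => ->; rewrite vX aX bX.
Qed.

Lemma K4_or_henneberg2 v : #|neighbours v| = 3 ->
  is_K4 (v |: neighbours v) \/
  exists2 H : sgraph, tight H /\ #|H| = #|G|.-1 & henneberg2 H G.
Proof.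
move=> deg3.
have [a [b [c [Nv ab ac bc]]]] : exists a b c,
    [/\ neighbours v = [set a; b; c], a != b, a != c & b != c].
  have /card_gt0P[c cN] : 0 < #|neighbours v| by rewrite deg3.
  have : #|neighbours v :\ c| == 2.
    by have := cardsD1 c (neighbours v); rewrite cN deg3; lia.
  case/cards2P=> a [b [ab e]]; exists a, b, c.
  have : a \in neighbours v :\ c by rewrite e !inE eqxx.
  have : b \in neighbours v :\ c by rewrite e !inE eqxx orbT.
  by rewrite !inE => /andP[bc _] /andP[ac _]; split; rewrite // setUC -e setD1K.
(* [blocked_adj] concludes about its first two vertices only, so the three pairs need three orders
   of the neighbours. *)
have Nv1 : neighbours v = [set a; c; b] by rewrite Nv setUAC.
have Nv2 : neighbours v = [set b; c; a] by rewrite Nv -setUA setUC.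
have cb : c != b by rewrite eq_sym.
have ba : b != a by rewrite eq_sym.
have ca : c != a by rewrite eq_sym.
have [bab|] := blocked_or_henneberg2 Nv ab ac bc; last by right.
have [bac|] := blocked_or_henneberg2 Nv1 ac ab cb; last by right.
have [bbc|] := blocked_or_henneberg2 Nv2 bc ba ca; last by right.
have blockedC x y : blocked v x y -> blocked v y x.
  rewrite /blocked sedge_sym => /orP[->//|/existsP[X /and4P[tX vX xX yX]]].
  by apply/orP; right; apply/existsP; exists X; rewrite tX vX xX yX.
have eab := blocked_adj Nv ab ac bc bab bac bbc.
have eac := blocked_adj Nv1 ac ab cb bac bab (blockedC _ _ bbc).
have ebc := blocked_adj Nv2 bc ba ca bbc (blockedC _ _ bab) (blockedC _ _ bac).
left; split; first by rewrite cardsU1 inE sedge_irrefl deg3.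
have vN x : x \in neighbours v -> v -- x by rewrite inE.
move=> x y; rewrite !in_setU1 => /orP[/eqP->|xN] /orP[/eqP->|yN]; rewrite ?eqxx //.
- by move=> _; apply: vN.
- by move=> _; rewrite sedge_sym; apply: vN.
move: xN yN; rewrite Nv !inE -!orbA.
by do 2![case/or3P=> /eqP->]; rewrite ?eqxx // sedge_sym.
Qed.

(** * A K4 that cannot be contracted *)

Lemma cross0_adj (A B : {set G}) x y : cross A B = 0 ->
  x \in A -> y \in B -> ~~ (x -- y).
Proof.
move=> /eqP; rewrite /cross sum_nat_eq0 => /forall_inP h xA yB.
have := h x xA; rewrite sum_nat_eq0 => /forall_inP/(_ y yB).
by case: (x -- y).
Qed.

Lemma K4_reduction (K : {set G}) : is_K4 K ->
  (forall w, w \notin K -> #|neighbours w :&: K| <= 1) \/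
  exists2 H : sgraph, tight H /\ #|H| = #|G|.-1 & edge_to_K3 H G.
Proof.
move=> K4.
have [h|] := boolP [forall w, (w \notin K) ==> (#|neighbours w :&: K| <= 1)].
  by left=> w; apply/implyP/(forallP h).
rewrite negb_forall => /existsP[w0]; rewrite negb_imply -ltnNge => /andP[wK nw].
right.
(* The property to be maximised; it holds first for [K] together with [w0]. *)
pose P M := tight_set M && [exists w in M, [exists x, [exists y,
  (neighbours w :&: M == [set x; y]) && (x -- y)]]].
have Padd M z x y : tight_set M -> x \in M -> y \in M -> z \notin M -> x -- y ->
    z -- x -> z -- y -> P (z |: M).
  move=> tM xM yM zM xy zx zy.
  have [tz nz] := tight_set_add tM xM yM zM (sedge_neq xy) zx zy.
  rewrite /P tz; apply/exists_inP; exists z; first by rewrite setU11.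
  apply/existsP; exists x; apply/existsP; exists y; rewrite xy andbT -nz.
  apply/eqP/setP=> t; rewrite !inE.
  by case: eqP => [->|//]; rewrite sedge_irrefl.
have tK : tight_set K by rewrite /tight_set (cross_K4 K4); case: K4 => ->.
have [x0 [y0 [x0K y0K x0y0 wx0 wy0]]] : exists x y,
    [/\ x \in K, y \in K, x -- y, w0 -- x & w0 -- y].
  have /card_gt1P[x [y]] := nw; rewrite !inE => -[/andP[wx xK] /andP[wy yK] xy].
  by exists x, y; split=> //; apply: K4.2.
have PM0 := Padd K w0 x0 y0 tK x0K y0K wK x0y0 wx0 wy0.
case: (arg_maxnP (fun M : {set G} => #|M|) PM0) => M /andP[tM].
case/exists_inP=> w wM /existsP[x /existsP[y /andP[/eqP Nw xy]]] maxM.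
(* Otherwise adding [z] would give a larger set with [P]. *)
have Mclosed z p q : p \in M -> q \in M -> p -- q -> z -- p -> z -- q -> z \in M.
  move=> pM qM pq zp zq; apply: contraT => zM.
  by have := maxM _ (Padd M z p q tM pM qM zM pq zp zq); rewrite cardsU1 zM add1n /= ltnn.
have [xN yN] : x \in neighbours w :&: M /\ y \in neighbours w :&: M.
  by rewrite Nw !inE !eqxx orbT.
have [wx xM] : w -- x /\ x \in M by move: xN; rewrite !inE => /andP[].
have [wy yM] : w -- y /\ y \in M by move: yN; rewrite !inE => /andP[].
have xw : x -- w by rewrite sedge_sym.
have yw : y -- w by rewrite sedge_sym.
have yx : y -- x by rewrite sedge_sym.
(* A common neighbour of [w] and [p] lies in [M] by closedness, so it is a neighbour of [w] in [M]
   other than [p], hence [q]. *)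
have third p q z : [set p; q] = [set x; y] -> p -- q -> w -- p -> p \in M ->
    z -- w -> z -- p -> z = q.
  move=> pqE pq wp pM zw zp; have zM := Mclosed z w p wM pM wp zw zp.
  have : z \in neighbours w :&: M by rewrite !inE sedge_sym zw.
  by rewrite Nw -pqE !inE (negPf (sedge_neq zp)) => /eqP.
have uniq_y z : z -- w -> z -- x -> z = y by apply: third.
have uniq_x z : z -- w -> z -- y -> z = x by apply: third; rewrite // setUC.
have card_pair p : w -- p -> #|contract [set w; p]| = #|G|.-1.
  by move=> wp; have := card_contract [set w; p]; rewrite cards2 (sedge_neq wp) addn2 => -[<-].
(* The obstacle to contracting [wp], whose only triangle has third vertex [q]: a set violating
   [tightN]. *)
pose bad p q := [exists X : {set G}, [&& tight_set X, w \in X, p \in X & q \notin X]].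
have badP p q : ~~ bad p q ->
    forall X, w \in X -> p \in X -> q \notin X -> ~~ tight_set X.
  rewrite negb_exists => /forallP h X wX pX qX; apply: contra (h X) => ->.
  by rewrite wX pX qX.
have [/existsP[X /and4P[tX wX xX yX]]|nb] := boolP (bad x y); last first.
  exists (contract [set w; x]); last exact: edge_contraction wx yw yx uniq_y.
  split; last exact: card_pair.
  exact: tight_contract_edge wx yw yx uniq_y (badP _ _ nb) tG.
have [/existsP[Y /and4P[tY wY yY xY]]|nb] := boolP (bad y x); last first.
  exists (contract [set w; y]); last exact: edge_contraction wy xw xy uniq_x.
  split; last exact: card_pair.
  exact: tight_contract_edge wy xw xy uniq_x (badP _ _ nb) tG.
(* Both contractions are obstructed; [X] and [Y] share [w], while [xy] joins their differences. *)
have XY0 : X :&: Y != set0 by apply/set0Pn; exists w; rewrite inE wX.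
have [_ c0] := tight_set_meet tX tY XY0.
by have := cross0_adj c0 (x := x) (y := y); rewrite !inE xX xY yX yY xy => /(_ isT isT).
Qed.

(** * Small tight graphs and the induction *)

Lemma tight_card_geq4 : #|G| <> 1 -> 4 <= #|G|.
Proof.
(* Tightness excludes n = 0 and requires 4n - 4 to be at most n(n - 1), which leaves n = 1 or n at
   least 4. *)
move=> G1; have /eqP := tG.2; have := cross_bound [set: G]; rewrite cardsT.
by move: #|G| G1 => [|[|[|[|n]]]] //=; lia.
Qed.

Lemma tight_card4 : #|G| = 4 -> iso (complete 4) G.
Proof.
move=> G4.
have adj x y : x != y -> x -- y.
  move=> xy; apply: contraT => nxy.
  (* A missing edge at [x] leaves at most 2 edges at [x] and 3 among the other three vertices, fewer
     than the 6 that tightness requires. *)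
  have := cross_bound [set~ x]; rewrite cardsC1 G4 => b1.
  have /eqP := tG.2; rewrite cardsT G4 (crossD1 (in_setT x)).
  have <- : [set~ x] = setT :\ x by apply/setP=> z; rewrite !inE andbT.
  have : #|neighbours x :&: [set~ x]| <= #|[set~ x] :\ y|.
    apply/subset_leq_card/subsetP=> z; rewrite !inE => /andP[xz ->].
    by rewrite andbT; apply: contraTneq xz => ->.
  have := cardsD1 y [set~ x]; rewrite cardsC1 G4 !inE eq_sym xy; lia.
exists (enum_val \o cast_ord (esym G4)).
  by apply: bij_comp; [apply: enum_val_bij |
    exists (cast_ord G4) => i; rewrite ?cast_ordK ?cast_ordKV].
move=> x y /=; rewrite /complete_rel; have [->|xy] := eqVneq x y.
  by rewrite sedge_irrefl.
by apply: adj; rewrite (inj_eq enum_val_inj) (inj_eq (@cast_ord_inj _ _ _)).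
Qed.

(** The bound [1 < #|H|] keeps the induction away from the one-vertex graph, which is tight but out
    of reach of the moves from K4. *)
Lemma tight_reduction : 4 < #|G| ->
  exists2 H : sgraph, [/\ tight H, 1 < #|H| & #|H| < #|G|]
    & [\/ henneberg1 H G, henneberg2 H G, vertex_to_K4 H G | edge_to_K3 H G].
Proof.
move=> G4; have [v deg3] := exists_degree_leq3.
have deg2 : 1 < #|neighbours v| by apply: degree_geq2; lia.
have [d3|d3] := eqVneq #|neighbours v| 3; last first.
  have [|H [tH cH] st] := @henneberg1_inverse v; first by lia.
  by exists H; [split; rewrite // cH; lia|constructor 1].
have [K4|[H [tH cH] st]] := K4_or_henneberg2 d3; last first.
  by exists H; [split; rewrite // cH; lia|constructor 2].
have [K1|[H [tH cH] st]] := K4_reduction K4; last first.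
  by exists H; [split; rewrite // cH; lia|constructor 4].
exists (contract (v |: neighbours v)).
  have := card_contract (v |: neighbours v); rewrite K4.1 => cc.
  by split; [apply/(tight_contract_K4 K4 K1) | lia | lia].
by constructor 3; exists (v |: neighbours v); split=> //; apply: iso_refl.
Qed.

End Reduction.

Lemma derivable_tight (G : sgraph) : #|G| <> 1 -> tight G ->
  derivable_from (complete 4) G.
Proof.
have [n] := ubnP #|G|; elim: n => // n IH in G *; rewrite ltnS => Gn G1 tG.
have := tight_card_geq4 tG G1; rewrite leq_eqVlt => /orP[/eqP/esym G4|G4].
  by apply: derivable_base; apply: tight_card4.
have [H [tH H1 HG] st] := tight_reduction tG G4.
by apply: derivable_step st; apply: IH => //; [apply: leq_trans HG Gn | lia].
Qed.

Theorem theorem1p5 (G : sgraph) (hG : #|G| <> 1) :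
  tight22 G <-> derivable_from (complete 4) G.
Proof.
rewrite tight22E; split; first exact: derivable_tight.
exact: tight_derivable.
Qed.
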